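(* Assume the Continuum Hypothesis. If $X$ is a $T_1$ topological space with a regular $G_\delta$-diagonal and caliber $\omega_1$, then $X$ is separable.
   Context: All spaces are topological $T_1$-spaces. For a space $X$ let $\Delta_X=\{(x,x):x\in X\}\subset X\times X$. $X$ has a regular $G_\delta$-diagonal if there is a countable family $\mathcal{U}$ of open subsets of $X\times X$ containing $\Delta_X$ such that $\Delta_X=\bigcap\{\overline{U}:U\in\mathcal{U}\}$ (closures in $X\times X$). $\omega_1$ is a caliber of $X$ (X has caliber $\omega_1$) if every uncountable family $\mathcal{U}$ of non-empty open subsets of $X$ has an uncountable subfamily $\mathcal{U}'$ such that $\bigcap\mathcal{U}'\neq\emptyset$. *)

(* Defs.v *)
From mathcomp Require Import all_boot.
From mathcomp Require Import boolp classical_sets cardinality filter topology.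

Set Implicit Arguments.
Unset Strict Implicit.
Unset Printing Implicit Defensive.

Local Open Scope classical_set_scope.
Local Open Scope card_scope.

(* No cardinality lies strictly between [aleph_0] and [2 ^ aleph_0]; the
   continuum is represented by the power set of [nat]. *)
Definition continuum_hypothesis : Prop :=
  forall A : set (set nat), countable A \/ A #= [set: set nat].

Definition regular_Gdelta_diagonal (X : topologicalType) : Prop :=
  exists2 U : set (set (X * X)),
    countable U /\ (forall O, U O -> open O /\ diagonal `<=` O) &
    diagonal = \bigcap_(O in U) closure O.

Definition caliber_omega1 (X : topologicalType) : Prop :=
  forall U : set (set X),
    (forall O, U O -> open O /\ O !=set0) -> ~ countable U ->
    exists V : set (set X),
      [/\ V `<=` U, ~ countable V & \bigcap_(O in V) O !=set0].

Definition separable (X : topologicalType) : Prop :=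
  exists2 D : set X, countable D & dense D.

(* Main.v *)
Require Import Defs.
From mathcomp Require Import all_boot.
From mathcomp Require Import boolp classical_sets cardinality filter topology.
From mathcomp Require Import functions wochoice.

(** Why it is true.  If omega_1 is a caliber of [X], then it is a caliber of
    [X * X] as well, so in both spaces every family of open sets has a
    countable subfamily whose union is dense in the union of the family
    ([caliber_omega1_prod], [caliber_omega1_dense_subfamily]).

    Let [u n] be open neighbourhoods of the diagonal whose closures meet in the
    diagonal.  Each [u n] contains a countable union of open boxes [A k * B k]
    that is dense in it.  For a set [S] of naturals let [W n S] be the
    complement of the closure of the union of the [B k] with [k] in [S].
    If [x <> p], then [(p, x)] lies outside some [closure (u n)], so it has a box
    neighbourhood [P * Q] disjoint from [u n]; for
    [S = {k | B k does not meet Q}] the set [W n S] contains [x] and is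
    disjoint from the section [u n [p] = {w | (p, w) in u n}]: if [w] were in both,
    some box would meet [P * W n S], so its index would be outside [S] and it
    would meet [P * Q].  Hence the at most continuum many open sets [W n S]
    suffice for all such separations
    ([regular_Gdelta_diagonal_separation]).

    It follows that [X] has at most continuum many points
    ([regular_Gdelta_diagonal_card]).  For each of the continuum many double
    sequences [E n j] of sets of naturals, choose, if possible, a point [e E]
    outside the union over [n] of the closures of [\bigcup_j W n (E n j)].
    Every point [p] is chosen: let [E n j], [j : nat], enumerate a countable
    family with dense union in the union of all the [W n S] disjoint from
    [u n [p]].  The neighbourhoods [u n [p]] keep [p] out of the closures, so
    [e E] lies outside them too; if [e E] were not [p], it would lie in some
    [W n S] disjoint from [u n [p]], hence in one of the closures.

    Under the continuum hypothesis the points of [X] can thus be listed as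
    [f c], with [c] ranging over a set ordered so that all initial segments are
    countable.  If [X] is not separable, the complements of the closures of the
    images of initial segments form an uncountable indexed family of nonempty
    open sets, and each point belongs to its members for only countably many
    indices: this contradicts the caliber ([caliber_omega1_indexed]). *)

Set Implicit Arguments.
Unset Strict Implicit.
Unset Printing Implicit Defensive.

Local Open Scope classical_set_scope.
Local Open Scope card_scope.

(** * Countability and the continuum hypothesis *)

Lemma uncountable_set_nat : ~ countable [set: set nat].
Proof.
move=> /countable_injP[f injf].
pose D := [set n | exists2 S : set nat, f S = n & ~ S n].
have DE : D (f D) <-> ~ D (f D).
  split=> [[S fS nS]|nD]; last by exists D.
  by rewrite -[X in ~ X _](injf S D) ?inE.
by have nD : ~ D (f D) by [move=> d; apply/DE: (d)]; apply: (nD); apply/DE.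
Qed.

Lemma countable_preimage (T U : Type) (f : T -> U) (B : set U) :
  injective f -> countable B -> countable (f @^-1` B).
Proof.
move=> injf /countable_injP[g injg]; apply/countable_injP; exists (g \o f).
move=> x y; rewrite !inE => Bx By /= /injg.
by rewrite !inE => /(_ Bx By)/injf.
Qed.

(** Sierpinski's decomposition of the square of the continuum: all vertical
    sections of [r] and all horizontal sections of its complement are countable.
    Here [r x y] says that [y] precedes or equals [x] in an order of type
    omega_1. *)
Lemma continuum_hypothesis_sierpinski : continuum_hypothesis ->
  exists r : set nat -> set nat -> Prop,
    (forall x, countable [set y | r x y]) /\
    (forall y, countable [set x | ~ r x y]).
Proof.
move=> CH; have [R woR] := well_ordering_principle (set nat).
have totR : total R.
  by move=> x y; apply: (@wo_chainW _ R predT) => // A _; exact: woR.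
(* [g] identifies [set nat] with a part of the well-order [R] all of whose
   initial segments are countable *)
suff [g injg segg] : exists2 g : set nat -> set nat, injective g &
    forall x, countable [set y | R y (g x)].
  exists (fun x y => R (g y) (g x)); split=> [x|y].
    exact: (countable_preimage injg (segg x)).
  apply: sub_countable (countable_preimage injg (segg y)).
  by apply: subset_card_le => x /= /negP; have /orP[->|->] := totR (g y) (g x).
have [segR|/existsNP[z uz]] := pselect (forall x, countable [set y | R y x]).
  by exists id.
have [|m [[/asboolP um minm] _]] :=
    woR [pred x | `[< ~ countable [set y | R y x] >]].
  by exists z; apply/asboolP.
(* [m] is least with an uncountable initial segment, so the predecessors of [m]
   are uncountably many, each with a countable initial segment *)
pose A := [set y | R y m /\ y <> m].
have uA : ~ countable A.
  move=> cA; apply: um.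
  apply: (@sub_countable _ _ _ (\bigcup_(B in [set A; [set m]]) B)).
    apply: subset_card_le => y Rym; have [->|ym] := pselect (y = m).
      by exists [set m] => //; right.
    by exists A => //; left.
  by apply: bigcup_countable => [|B [->|->]] //; exact: finite_set_countable.
have [//|/card_esym/card_set_bijP[g [gA /in2TT injg _]]] := CH A.
exists g => // x; apply: contrapT => ux.
have [Rgm gm] := gA x I.
have Rmg : R m (g x) by apply: minm; apply/asboolP.
apply: gm; apply: (@wo_chain_antisymmetric _ R predT) => //.
  by move=> B _; exact: woR.
by rewrite Rgm.
Qed.

(** * Spaces of caliber omega_1 *)

(** The caliber condition for indexed families: repetitions are harmless, since
    either uncountably many indices share the same open set, or the set of
    values is uncountable. *)
Lemma caliber_omega1_indexed (T : topologicalType) (I : Type) (J : set I)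
    (F : I -> set T) :
  caliber_omega1 T -> (forall i, J i -> open (F i) /\ F i !=set0) ->
  ~ countable J -> exists x, ~ countable [set i | J i /\ F i x].
Proof.
move=> calT oF uJ; have [cFJ|uFJ] := pselect (countable (F @` J)).
  apply: contrapT => /forallNP cfib; apply: uJ.
  apply: (@sub_countable _ _ _
    (\bigcup_(O in F @` J) [set i | J i /\ F i = O])).
    by apply: subset_card_le => i Ji; exists (F i) => //; exists i.
  apply: bigcup_countable => // _ [i Ji <-].
  have [_ [x Fix]] := oF _ Ji; have /contrapT := cfib x; apply: sub_countable.
  by apply: subset_card_le => j [Jj /= FjE]; split=> //; rewrite FjE.
have [|V [VFJ uV [x Vx]]] := calT _ _ uFJ.
  by move=> _ [i Ji <-]; exact: oF.
exists x => cK; apply: uV.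
apply: sub_countable (sub_countable (card_image_le F _) cK).
apply: subset_card_le => O VO; have [i Ji FiO] := VFJ _ VO.
by exists i => //; split=> //; rewrite FiO; exact: Vx.
Qed.

Lemma open_setX_nbhs (T U : topologicalType) (O : set (T * U)) (p : T * U) :
  nbhs p O -> exists AB : set T * set U,
    [/\ open_nbhs p.1 AB.1, open_nbhs p.2 AB.2 & AB.1 `*` AB.2 `<=` O].
Proof.
move=> [[P Q] /= []]; rewrite !nbhsE => -[A oA AP] [B oB BQ] PQO.
by exists (A, B); split=> // -[x y] /= [/AP Px /BQ Qy]; apply: PQO.
Qed.

Lemma caliber_omega1_prod (T U : topologicalType) :
  caliber_omega1 T -> caliber_omega1 U -> caliber_omega1 (T * U)%type.
Proof.
move=> calT calU F oF uF.
have /choice[box boxP] : forall O, exists AB : set T * set U, F O ->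
    [/\ open AB.1 /\ AB.1 !=set0, open AB.2 /\ AB.2 !=set0 &
        AB.1 `*` AB.2 `<=` O].
  move=> O; have [FO|nFO] := pselect (F O); last by exists (set0, set0).
  have [oO [p Op]] := oF _ FO.
  have [AB [[oA Ap] [oB Bp] ABO]] :=
    open_setX_nbhs (open_nbhs_nbhs (conj oO Op)).
  by exists AB => _; split=> //; split=> //; [exists p.1|exists p.2].
have [|x ux] := @caliber_omega1_indexed _ _ F (fst \o box) calT _ uF.
  by move=> O /boxP[].
have [|y uy] := @caliber_omega1_indexed _ _ _ (snd \o box) calU _ ux.
  by move=> O [/boxP[]].
exists [set O | (F O /\ (fst \o box) O x) /\ (snd \o box) O y]; split=> //.
  by move=> O [[]].
by exists (x, y) => O [[FO /= Ax] By]; have [_ _] := boxP _ FO; apply.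
Qed.

(** The countable chain condition in the form used below: countably many members
    of an open family have a union dense in the union of the whole family. *)
Lemma caliber_omega1_dense_subfamily (T : topologicalType) (I : Type)
    (J : set I) (F : I -> set T) :
  caliber_omega1 T -> (forall i, J i -> open (F i)) -> J !=set0 ->
  exists2 s : nat -> I, (forall k, J (s k)) &
    \bigcup_(i in J) F i `<=` closure (\bigcup_k F (s k)).
Proof.
move=> calT oF [i0 Ji0].
(* A maximal disjoint collection [D] of nonempty open sets, each contained in
   some [F i], is countable, and its union is dense in that of the [F i]. *)
pose B := [set O | [/\ open O, O !=set0 & exists2 i, J i & O `<=` F i]].
have [D [DB tD maxD]] := ex_maximal_disjoint_subcollection id B.
have /countable_injP[f injf] : countable D.
  apply: contrapT => uD.
  have [|x ux] := @caliber_omega1_indexed _ _ D id calT _ uD.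
    by move=> O /DB[].
  apply: ux; have [[O [DO Ox]]|/forallNP noO] := pselect (exists O, D O /\ O x).
    apply: sub_countable (countable1 O); apply: subset_card_le => P [DP Px].
    by apply: tD => //; exists x.
  by apply: sub_countable (countable0 (set T)); apply: subset_card_le => P /noO.
(* [s] picks for the [k]-th member of [D], numbered by [f], an [F i] containing
   it; unused numbers are sent to the default index [i0]. *)
have /choice[s sP] : forall k, exists i, J i /\
    forall O, D O -> f O = k -> O `<=` F i.
  move=> k; have [[O [DO <-]]|noO] := pselect (exists O, D O /\ f O = k).
    have [_ _ [i Ji OFi]] := DB _ DO; exists i; split=> // P DP fPO.
    by rewrite (injf P O) ?inE.
  by exists i0; split=> // O DO fO; exfalso; apply: noO; exists O.
exists s => [k|x [i Ji Fix] N]; first by have [] := sP k.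
rewrite nbhsE => -[M [oM Mx] MN]; apply: contrapT => disj.
have NF k y : F (s k) y -> N y -> False.
  by move=> Fy Ny; apply: disj; exists y; split=> //; exists k.
have DF O y : D O -> O y -> N y -> False.
  by move=> DO Oy; apply: (NF (f O)); exact: ((sP (f O)).2 O DO erefl y Oy).
pose O := M `&` F i.
apply: (maxD (O |` D)).
- split=> [P DP|/(_ O (or_introl erefl)) DO]; first by right.
  by apply: (DF O x) => //; exact: MN.
- move=> _ [->|/DB//]; split; first by apply: openI => //; exact: oF.
    by exists x; split.
  by exists i => // y [].
- move=> P Q [->|DP] [->|DQ] [y [Py Qy]] //; last by apply: tD => //; exists y.
  + by exfalso; apply: (DF Q y) => //; apply: MN; case: Py.
  + by exfalso; apply: (DF P y) => //; apply: MN; case: Qy.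
Qed.

(** * Cardinality of spaces with a regular G_delta diagonal *)

Lemma regular_Gdelta_diagonal_seq (X : topologicalType) :
  regular_Gdelta_diagonal X ->
  exists u : nat -> set (X * X),
    (forall n, open (u n) /\ diagonal `<=` u n) /\
    (forall x y, x <> y -> exists n, ~ closure (u n) (x, y)).
Proof.
move=> [U [cU oU] diagE].
have sepU x y : x <> y -> exists2 O, U O & ~ closure O (x, y).
  move=> xy; apply: contrapT => noO; apply: xy.
  suff : (diagonal : set (X * X)) (x, y) by [].
  rewrite diagE => O UO; apply: contrapT => nO; apply: noO.
  by exists O.
have [U0|[u]] := pfcard_geP cU.
  exists (fun=> setT); split=> [n|x y /sepU[O]]; last by rewrite U0.
  by split=> //; exact: openT.
exists u; split=> [n|x y /sepU[O UO nO]]; first by apply: oU; exact: funS.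
by have [n _ unO] := @surj _ _ _ _ u O UO; exists n; rewrite unO.
Qed.

(** The open sets [W n S], indexed by naturals and sets of naturals, separate
    any [x] from any other point [p] uniformly: some [W n S] contains [x] and is
    disjoint from the neighbourhood [{w | u n (p, w)}] of [p], which depends on
    [p] and [n] only.  As [W n setT] is empty, for all [n] and [p] some [W n S]
    is disjoint from that neighbourhood. *)
Lemma regular_Gdelta_diagonal_separation (X : topologicalType) :
  regular_Gdelta_diagonal X -> caliber_omega1 X ->
  exists (u : nat -> set (X * X)) (W : nat -> set nat -> set X),
    [/\ forall n, open (u n) /\ diagonal `<=` u n,
        forall n S, open (W n S),
        forall n, W n setT = set0 &
        forall p x, x <> p -> exists n S,
          W n S x /\ forall w, W n S w -> ~ u n (p, w)].
Proof.
move=> /regular_Gdelta_diagonal_seq[u [oud sepu]] calX.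
pose box (AB : set X * set X) := AB.1 `*` AB.2.
pose J n := [set AB | [/\ open AB.1, open AB.2 & box AB `<=` u n]].
have /choice[s sP] : forall n, exists s : nat -> set X * set X,
    (forall k, J n (s k)) /\ u n `<=` closure (\bigcup_k box (s k)).
  move=> n; have oJ AB : J n AB -> open (box AB).
    move=> [oA oB _]; rewrite openE => -[x y] [/= Ax By].
    by exists AB => //; split; apply: open_nbhs_nbhs.
  have [|s Js sd] :=
    caliber_omega1_dense_subfamily (caliber_omega1_prod calX calX) oJ.
    by exists (set0, set0); split; [exact: open0|exact: open0|move=> ? []].
  exists s; split=> // -[x y] uxy; apply: sd.
  have [AB [[oA Ax] [oB By] ABu]] :=
    open_setX_nbhs (open_nbhs_nbhs (conj (oud n).1 uxy)).
  by exists AB.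
(* density in [u n] of the union of the boxes, on basic neighbourhoods *)
have meet n x y A B : u n (x, y) -> nbhs x A -> nbhs y B ->
    exists k, ((s n k).1 `&` A !=set0) /\ ((s n k).2 `&` B !=set0).
  move=> uxy nA nB; have [_ /(_ _ uxy) cl] := sP n.
  have [|[a b] [[k _ [/= ka kb]] [/= Aa Bb]]] := cl (A `*` B).
    by exists (A, B).
  by exists k; split; [exists a|exists b].
exists u, (fun n S => ~` closure (\bigcup_(k in S) (s n k).2)).
split=> [//|n S|n|p x xp].
- exact/closed_openC/closed_closure.
- rewrite -subset0 => x /= nclx; apply: nclx => N Nx.
  have [|k [_ [b [kb Nb]]]] := meet n x x setT N _ filterT Nx.
    exact: (oud n).2.
  by exists b; split=> //; exists k.
have [n ncl] : exists n, ~ closure (u n) (p, x) by apply: sepu; exact/nesym.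
have [PQ [Pp Qx PQu]] : exists PQ : set X * set X,
    [/\ open_nbhs p PQ.1, open_nbhs x PQ.2 & PQ.1 `*` PQ.2 `<=` ~` u n].
  have nbC : nbhs (p, x) (~` closure (u n)).
    by apply: open_nbhs_nbhs; split=> //; exact/closed_openC/closed_closure.
  have [PQ [Pp Qx PQC]] := open_setX_nbhs nbC; exists PQ; split=> // z /PQC.
  by apply: contra_not; exact: subset_closure.
(* the boxes whose second side misses the neighbourhood [PQ.2] of [x] *)
exists n, [set k | (s n k).2 `&` PQ.2 = set0]; split=> [/= clx|w nclw upw].
  have [b [[k /= k0 kb] Qb]] := clx _ (open_nbhs_nbhs Qx).
  by have : set0 b by rewrite -k0; split.
have [|k [[a [ka Pa]] [b [kb nclb]]]] :=
    meet n p w PQ.1 _ upw (open_nbhs_nbhs Pp) (open_nbhs_nbhs (conj _ nclw)).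
  exact/closed_openC/closed_closure.
have [c [kc Qc]] : (s n k).2 `&` PQ.2 !=set0.
  apply/set0P/eqP => k0; apply: nclb; apply: subset_closure.
  by exists k.
have [[_ _ ku] _] := ((sP n).1 k, I).
by apply: (PQu (a, c)); [split|apply: ku; split].
Qed.

(** Buzyakova's bound by the continuum, for spaces of caliber omega_1. *)
Lemma regular_Gdelta_diagonal_card (X : topologicalType) :
  regular_Gdelta_diagonal X -> caliber_omega1 X ->
  [set: X] #<= [set: set nat].
Proof.
move=> diagX calX.
have [X0|/set0P[x0 _]] := eqVneq [set: X] set0; first by rewrite X0.
have [u [W [oud oW W0 sepW]]] := regular_Gdelta_diagonal_separation diagX calX.
(* [e] chooses a point outside [Z E] whenever there is one *)
pose Z (E : nat -> nat -> set nat) :=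
  \bigcup_n closure (\bigcup_j W n (E n j)).
have /choice[e eP] : forall E, exists x, ~` Z E !=set0 -> ~ Z E x.
  move=> E; have [[x nZ]|noZ] := pselect (~` Z E !=set0); first by exists x.
  by exists x0.
have e_surj p : exists E, e E = p.
  pose J n := [set S | forall w, W n S w -> ~ u n (p, w)].
  have /choice[E EP] : forall n, exists s : nat -> set nat,
      (forall j, J n (s j)) /\
      \bigcup_(S in J n) W n S `<=` closure (\bigcup_j W n (s j)).
    move=> n; have [|s Js sd] :=
      caliber_omega1_dense_subfamily calX (fun S (_ : J n S) => oW n S).
      by exists setT; rewrite /J /= W0.
    by exists s.
  exists E; apply: contrapT => /sepW[n [S [WeS JS]]].
  apply: (eP E); last by exists n => //; apply: (EP n).2; exists S.
  exists p => -[m _ clp].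
  have [AB [[_ Ap] Bp ABu]] :=
    open_setX_nbhs (open_nbhs_nbhs (conj (oud m).1 ((oud m).2 (p, p) erefl))).
  have [w [[j _ Ww] Bw]] := clp _ (open_nbhs_nbhs Bp).
  by apply: ((EP m).1 j w Ww); apply: ABu.
(* double sequences of sets of naturals are coded by sets of naturals *)
pose decode (C : set nat) (n j : nat) :=
  [set k : nat | C (choice.pickle (n, j, k))].
have /Psurj[g _] : set_surj [set: set nat] [set: X] (e \o decode).
  move=> p _; have [E <-] := e_surj p.
  exists [set c | if choice.unpickle c is Some (n, j, k) then E n j k
                  else False] => //=.
  congr e; apply/funext => n; apply/funext => j; apply/funext => k.
  by rewrite /decode /= choice.pickleK.
exact: surj_card_ge g.
Qed.

Theorem theorem3p1 (CH : continuum_hypothesis) (X : topologicalType)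
    (T1X : accessible_space X) (diagX : regular_Gdelta_diagonal X)
    (calX : caliber_omega1 X) :
  separable X.
Proof.
have [X0|[f]] := pfcard_geP (regular_Gdelta_diagonal_card diagX calX).
  exists set0 => // O [x _]; have : [set: X] x by [].
  by rewrite X0.
have fK x : exists c, f c = x by have [c] := @surj _ _ _ _ f x I; exists c.
have [r [rL rR]] := continuum_hypothesis_sierpinski CH.
apply: contrapT => nsep.
(* [O c] omits [f b] for all [b] preceding or equal to [c] *)
pose O c := ~` closure (f @` [set b | r c b]).
have O_id c b : O c (f b) -> ~ r c b.
  by move=> nfb rcb; apply: nfb; apply: subset_closure; exists b.
have oO c : open (O c) /\ O c !=set0.
  split; first exact/closed_openC/closed_closure.
  apply: contrapT => O0; apply: nsep; exists (f @` [set b | r c b]).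
    exact: sub_countable (card_image_le _ _) (rL c).
  move=> N [x Nx] oN; have clx : closure (f @` [set b | r c b]) x.
    by apply: contrapT => nclx; apply: O0; exists x.
  by rewrite setIC; apply: clx; exact: open_nbhs_nbhs.
have [|x] := @caliber_omega1_indexed _ _ setT O calX _ uncountable_set_nat.
  by move=> c _; exact: oO.
have [b <-] := fK x; apply; apply: sub_countable (rR b).
by apply: subset_card_le => c [_ /O_id].
Qed.
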